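(* Let $N$ be a finite group and let $$D = \{(d^{-1}, \gamma_d) : d \in N'\},$$ which is a normal subgroup of $\mathrm{Hol}(N) = N \rtimes \mathrm{Aut}(N)$. Then Gaschütz's theorem holds for $N$ if and only if both of the following hold: $\mathrm{Z}(N) \cap N' = 1$, and $N$ has a complement in $\mathrm{Hol}(N)/D$, where $N$ is identified with its natural image $(N\times 1)D/D$ in this quotient.
   Context: All groups are finite. $N'$ denotes the commutator (derived) subgroup of $N$, and $\mathrm{Z}(N)$ its center. A complement of a normal subgroup $N \unlhd G$ is a subgroup $C \le G$ with $G = NC$ and $N \cap C = 1$. ''Gaschütz's theorem holds for $N$'' means: for all finite groups $G$ and $H$ with $N \unlhd G$, $N \le H \le G$ and $\gcd(|N|, [G:H]) = 1$, if $N$ has a complement in $H$, then $N$ has a complement in $G$. For $x \in N$, $\gamma_x \in \mathrm{Aut}(N)$ is the inner automorphism $\gamma_x(y) = xyx^{-1}$. The holomorph is $\mathrm{Hol}(N) = N \rtimes \mathrm{Aut}(N)$ with multiplication $(n,\alpha)(m,\beta) = (n\alpha(m), \alpha\beta)$. *)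

(* Defs.v *)
From mathcomp Require Import all_boot all_fingroup all_solvable.

Set Implicit Arguments.
Unset Strict Implicit.
Unset Printing Implicit Defensive.

Local Open Scope group_scope.

(* G is an arbitrary finite group with a normal subgroup M isomorphic to N;   *)
(* it need not live in the ambient type of N.                                 *)
Definition gaschutz_holds (gT : finGroupType) (N : {group gT}) : Prop :=
  forall (rT : finGroupType) (M H G : {group rT}),
    M \isog N -> M <| G -> M \subset H -> H \subset G ->
    coprime #|M| #|G : H| ->
    [splits H, over M] -> [splits G, over M].

Notation hol N := (sdprod_by (aut_groupAction N)).

Section Holomorph.

Variables (gT : finGroupType) (N : {group gT}).

(* y ^ x is x^-1 * y * x, so conjugation by x on the left is by x^-1 here.    *)
Definition inner_aut (x : gT) : {perm gT} := conj_aut N x^-1.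

Lemma inner_autE : {in N &, forall x y, inner_aut x y = x * y * x^-1}.
Proof.
by move=> x y Nx Ny; rewrite /inner_aut conj_autE ?groupV // conjgE invgK mulgA.
Qed.

Lemma inner_aut_Aut x : inner_aut x \in Aut N.
Proof. exact: Aut_aut. Qed.

(* The pair (n, a) of N x Aut(N). Products of permutations are read from left *)
(* to right and sdprod_by is built from a right action, so the automorphism   *)
(* a, acting on the left, is represented by a^-1. In hol_pairM, b * a is the  *)
(* composite y |-> a (b y).                                                   *)
Definition hol_pair (n : gT) (a : {perm gT}) : hol N :=
  sdpair1 (aut_groupAction N) n * sdpair2 (aut_groupAction N) a^-1.

Lemma hol_pairM n a m b : n \in N -> a \in Aut N -> m \in N -> b \in Aut N ->
  hol_pair n a * hol_pair m b = hol_pair (n * a m) (b * a).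
Proof.
move=> Nn Aa Nm Ab; have Nam: a m \in N by rewrite Aut_closed.
rewrite /hol_pair invMg sdpair1_morphM // sdpair2_morphM ?groupV //.
have ->: sdpair1 (aut_groupAction N) (a m)
         = sdpair1 (aut_groupAction N) m ^ sdpair2 (aut_groupAction N) a.
  by rewrite -sdpair_act.
have ->: sdpair2 (aut_groupAction N) a^-1 = (sdpair2 (aut_groupAction N) a)^-1.
  by rewrite (morphV (sdpair2_morphism (aut_groupAction N))).
by rewrite conjgE !mulgA mulgK.
Qed.

Lemma hol_pairP (u : hol N) :
  exists n a, [/\ n \in N, a \in Aut N & u = hol_pair n a].
Proof.
have /imset2P[x y /morphimP[n _ Nn ->] /morphimP[a _ Aa ->] ->] :
  u \in sdpair1 (aut_groupAction N) @* N * sdpair2 (aut_groupAction N) @* Aut N.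
  by rewrite im_sdpair inE.
by exists n, a^-1; rewrite groupV /hol_pair invgK.
Qed.

Definition hol_base : {group hol N} :=
  [group of sdpair1 (aut_groupAction N) @* N].

Definition hol_diag : {set hol N} :=
  [set hol_pair d^-1 (inner_aut d) | d in N^`(1)].

Lemma hol_diag_group_set : group_set hol_diag.
Proof.
have sN := subsetP (der_sub 1 N).
apply/group_setP; split.
  apply/imsetP; exists 1; rewrite ?group1 // /hol_pair /inner_aut !invg1.
  rewrite (morph1 (conj_aut_morphism N)) invg1.
  by rewrite (morph1 (sdpair1_morphism _)) (morph1 (sdpair2_morphism _)) mulg1.
move=> _ _ /imsetP[d N'd ->] /imsetP[e N'e ->]; apply/imsetP.
exists (d * e); first by rewrite groupM.
rewrite hol_pairM ?groupV ?sN ?inner_aut_Aut //.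
rewrite inner_autE ?groupV ?sN // !mulgA mulVg mul1g -invMg.
congr hol_pair; rewrite /inner_aut invMg.
by rewrite conj_aut_morphM ?groupV ?(subsetP (normG N)) ?sN.
Qed.

Canonical hol_diag_group := Group hol_diag_group_set.

End Holomorph.

(* Main.v *)
(* Write D = hol_diag N and call L a lifted complement if D \subset L,        *)
(* hol_base N * L = hol N and hol_base N :&: L = 1. When Z(N) and N' meet     *)
(* trivially so do hol_base N and D, and lifted complements correspond to     *)
(* complements in the quotient hol N / D.                                     *)
(*                                                                            *)
(* From a lifted complement to complements: Gaschutz's theorem for the        *)
(* abelian group N / N' gives K <= G with N K = G and N :&: K = N'. If K acts *)
(* on N through the automorphisms c_k, then n k |-> (n, c_k) is well defined  *)
(* modulo D and maps G to hol N / D injectively on N; pull L back.            *)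
(*                                                                            *)
(* Conversely, put X = hol N, M = hol_base N, let p : X -> Aut N be the       *)
(* projection and R a nontrivial group of order prime to |N|. In X x (X wr R) *)
(* let G consist of the (x, (s, f)) with f i = x mod M for all i, modulo the  *)
(* diagonal copy of D. Let H <= G be defined by s = 1, of index |R|, and view *)
(* M as the subgroup of the (m, 1). The equation x = f 1 cuts out a           *)
(* complement of M in H, hence M has a complement L in G. By coprimality L    *)
(* contains R. For a, b in M, supported at one place i of R, L contains       *)
(* (m, a_i) and (n, b_i) with m, n in M, and (m, a_j) for j != i by           *)
(* conjugation with R. As [(m, a_j), (n, b_i)] = ([m, n], 1), we get          *)
(* [m, n] = 1, so that L contains (1, [a, b]_i) and finally all constant      *)
(* functions with values in M'. Thus the pullback of L along                  *)
(* x |-> (x, (1, const (p x))) contains D and is a lifted complement. Its     *)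
(* existence also forces M :&: D = 1, that is Z(N) :&: N' = 1.                *)
From HB Require Import structures.
Require Import Defs.
From mathcomp Require Import all_boot all_fingroup zmodp all_solvable.

Set Implicit Arguments.
Unset Strict Implicit.
Unset Printing Implicit Defensive.

Local Open Scope group_scope.

(** The scheme above rests on one observation: if G = N K and N :&: K = N', two factorizations n k
    of the same element differ by some d in N', and d acts on N as conjugation by d. The pair (n,
    c_k) in the holomorph is thus ambiguous exactly by [hol_diag N], so a subgroup L containing it
    can be pulled back to G. [splits_of_supplement_morphisms] does this in general, and
    [gaschutz_of_hol_complement] applies it to the supplement from [Gaschutz_derived_supplement].

    For the converse a single test group suffices. Coprimality forces the rotations into any
    complement ([rotL]), the rotations then force in the functions with values in M'
    ([single_commgL], [const_derL]), and these are the corrections needed to read off a lifted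
    complement ([complement_of_wreath_complement]). [splits_quotientP] passes between lifted
    complements and the quotient. *)

(** * Complements in quotients and the supplement modulo M' *)

Section QuotientComplements.

Variables (gT : finGroupType) (G K M : {group gT}).
Hypotheses (nKG : K <| G) (sMG : M \subset G).

Lemma mul_of_quotient_mul (L : {group gT}) :
  K \subset L -> L \subset G -> M / K * (L / K) = G / K -> M * L = G.
Proof.
move=> sKL sLG; have nKG' := normal_norm nKG.
have nKM := subset_trans sMG nKG'; have nKL := subset_trans sLG nKG'.
rewrite -quotientMl // => /(congr1 (fun A => coset K @*^-1 A)).
rewrite !quotientK // ?mul_subG // mulgA -(normC nKM) -mulgA.
by rewrite (mulSGid sKL) (mulSGid (normal_sub nKG)).
Qed.

(** If L / K meets M / K trivially, then M :&: L lies in K, hence in M :&: K = 1. *)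
Lemma splits_quotientP : M :&: K = 1 ->
  reflect (exists L : {group gT}, [/\ K \subset L, M * L = G & M :&: L = 1])
          [splits G / K, over M / K].
Proof.
move=> tiMK; have nKM := subset_trans sMG (normal_norm nKG).
apply: (iffP splitsP) => [[Lb /complP[tiL mulL]] | [L [sKL mulL tiL]]].
  have sLb : Lb \subset G / K by rewrite -mulL mulG_subr.
  have [L defLb sKL sLG] := inv_quotientS nKG sLb; rewrite defLb in tiL mulL.
  exists L; split=> //; first exact: mul_of_quotient_mul.
  apply/trivgP; rewrite -tiMK subsetI subsetIl -quotient_sub1 ?subIset ?nKM //.
  by rewrite /= quotientIG // tiL.
exists (L / K)%G; apply/complP; split.
  by rewrite -quotientIG // tiL quotient1.
by rewrite -quotientMl // mulL.
Qed.

End QuotientComplements.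

(** The classical theorem of Gaschütz applies modulo M', where M becomes abelian; K is the preimage
    of the complement found there. *)
Lemma Gaschutz_derived_supplement (gT : finGroupType) (M H G : {group gT}) :
    M <| G -> M \subset H -> H \subset G -> coprime #|M| #|G : H| ->
    [splits H, over M] ->
  exists K : {group gT}, M * K = G /\ M :&: K = M^`(1).
Proof.
move=> nMG sMH sHG coMGH /splitsP[C /complP[tiC mulC]].
have sM'M : M^`(1) \subset M := der_sub 1 M.
have nM'G : M^`(1) <| G by apply: gFnormal_trans.
have nM'H : H \subset 'N(M^`(1)) := subset_trans sHG (normal_norm nM'G).
have sMG := normal_sub nMG.
have: [splits G / M^`(1), over M / M^`(1)].
  rewrite (@Gaschutz_split _ _ _ (H / M^`(1))%G) ?quotientS ?quotient_normal //.
  - apply/splitsP; exists (C / M^`(1))%G; apply/complP; split.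
      by rewrite -quotientGI // tiC quotient1.
    by rewrite -quotientMl ?mulC // (subset_trans sMH).
  - exact: der_abelian 0 M.
  - rewrite index_quotient_eq ?(normal_norm nM'G) //; last first.
      by rewrite subIset // (subset_trans sM'M sMH) orbT.
    exact: coprime_dvdl (dvdn_quotient _ _) coMGH.
case/splitsP=> Kb /complP[tiK mulK].
have sKb : Kb \subset G / M^`(1) by rewrite -mulK mulG_subr.
have [K defKb sM'K sKG] := inv_quotientS nM'G sKb; rewrite defKb in tiK mulK.
exists K; split; first exact: mul_of_quotient_mul mulK.
apply/eqP; rewrite eqEsubset subsetI sM'M sM'K !andbT -quotient_sub1.
  by rewrite quotientGI // tiK.
by rewrite subIset // (subset_trans sMH nM'H).
Qed.

Lemma gaschutz_isog (aT bT : finGroupType) (N : {group aT}) (M : {group bT}) :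
  N \isog M -> gaschutz_holds N -> gaschutz_holds M.
Proof.
move=> isoNM gasN rT P H G isoPM; apply: gasN.
by rewrite (isog_trans isoPM) // isog_sym.
Qed.

(** * Wreath products over the regular action *)

(** The separate name lets the set of pairs carry the twisted product instead of the componentwise
    one. *)
Definition wreath (hT R : finGroupType) : Type := (R * {ffun R -> hT})%type.

Section WreathGroup.

Variables (hT R : finGroupType).

HB.instance Definition _ := Finite.copy (wreath hT R) (R * {ffun R -> hT})%type.

Definition wreath_one : wreath hT R := (1, [ffun _ => 1]).

Definition wreath_inv (u : wreath hT R) : wreath hT R :=
  (u.1^-1, [ffun i => (u.2 (u.1^-1 * i))^-1]).

Definition wreath_mul (u v : wreath hT R) : wreath hT R :=
  (u.1 * v.1, [ffun i => u.2 (v.1 * i) * v.2 i]).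

Lemma wreath_mulA : associative wreath_mul.
Proof.
move=> u v w; congr (_, _); rewrite /= ?mulgA //.
by apply/ffunP=> i; rewrite !ffunE !mulgA.
Qed.

Lemma wreath_mul1 : left_id wreath_one wreath_mul.
Proof.
case=> s f; congr (_, _); rewrite /= ?mul1g //.
by apply/ffunP=> i; rewrite !ffunE mul1g.
Qed.

Lemma wreath_mulV : left_inverse wreath_one wreath_inv wreath_mul.
Proof.
case=> s f; congr (_, _); rewrite /= ?mulVg //.
by apply/ffunP=> i; rewrite !ffunE mulKg mulVg.
Qed.

HB.instance Definition _ := Finite_isGroup.Build (wreath hT R)
  wreath_mulA wreath_mul1 wreath_mulV.

End WreathGroup.

(** * Pulling a complement back along a map defined modulo L *)

(** The complement consists of the m k with f m * h k in L. Two factorizations of one element give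
    the same left coset of L, and the compatibility of f with h makes the set closed under
    products. *)
Lemma splits_of_supplement_morphisms (gT xT : finGroupType)
    (M K G : {group gT}) (L : {group xT})
    (f : {morphism M >-> xT}) (h : {morphism K >-> xT}) :
    K \subset 'N(M) -> M * K = G -> 'injm f ->
    {in M & K, forall m k, f (m ^ k) = f m ^ h k} ->
    {in M :&: K, forall d, f d^-1 * h d \in L} ->
    f @* M :&: L = 1 -> h @* K \subset f @* M * L ->
  [splits G, over M].
Proof.
move=> /subsetP nMK defG injf fJ fhL tiL shL.
pose C := [set m * k | m in M, k in [set k in K | f m * h k \in L]].
have memJ m k : m \in M -> k \in K -> m ^ k \in M.
  by move=> Mm Kk; rewrite memJ_norm ?nMK.
have C_P g :
    reflect (exists m k, [/\ m \in M, k \in K, f m * h k \in L & g = m * k])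
            (g \in C).
  apply: (iffP imset2P) => [[m k Mm /setIdP[Kk Lmk] ->]|].
    by exists m, k.
  case=> m [k [Mm Kk Lmk ->]].
  by exists m k => //; rewrite inE Kk.
have gC : group_set C.
  apply/group_setP; split.
    by apply/C_P; exists 1, 1; rewrite !group1 !morph1 !mulg1 group1.
  move=> _ _ /C_P[m [k [Mm Kk Lmk ->]]] /C_P[n [l [Mn Kl Lnl ->]]].
  have Mn' : n ^ k^-1 \in M by rewrite memJ ?groupV.
  apply/C_P; exists (m * n ^ k^-1), (k * l); split.
  - exact: groupM.
  - exact: groupM.
  - have := groupM Lmk Lnl; rewrite (morphM f) // (morphM h) //.
    rewrite fJ ?groupV // (morphV h) //.
    by rewrite conjgE invgK !mulgA mulgKV.
  - by rewrite conjgE invgK !mulgA mulgKV.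
apply/splitsP; exists (Group gC); apply/complP; split.
  apply/trivgP/subsetP=> g /setIP[Mg /C_P[m [k [Mm Kk Lmk def_g]]]].
  rewrite def_g in Mg *.
  have Mk : k \in M by rewrite groupMl in Mg.
  (* The elements f (m * k) and f m * h k differ by the factor f k^-1 * h k, which lies in L. *)
  have Lf : f (m * k) \in L.
    have MKk : k \in M :&: K by rewrite inE Mk.
    rewrite -(groupMr _ (fhL _ MKk)) (morphM f) // (morphV f) //.
    by rewrite mulgA mulgK.
  have : f (m * k) \in f @* M :&: L by rewrite inE mem_morphim.
  by rewrite tiL => /set1P/(kerP _ Mg); apply: subsetP.
apply/eqP; rewrite eqEsubset -{1}defG; apply/andP; split.
  apply/subsetP=> _ /imset2P[m _ Mm /C_P[n [k [Mn Kk _ ->]]] ->].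
  by rewrite mulgA mem_mulg ?groupM.
apply/subsetP=> g; rewrite -defG => /imset2P[m k Mm Kk ->].
have /imset2P[_ l /morphimP[n _ Mn ->] Ll def_hk] : h k \in f @* M * L.
  by rewrite (subsetP shL) ?mem_morphim.
rewrite -(mulgK n m) -mulgA; apply: mem_mulg; [exact: groupM | apply/C_P].
by exists n^-1, k; rewrite groupV Mn Kk def_hk (morphV f) // mulKg.
Qed.

(** * The diagonal subgroup D of the holomorph *)

Section HolomorphDiagonal.

Variables (gT : finGroupType) (N : {group gT}).

Local Notation S := (sdpair1 (aut_groupAction N)).
Local Notation T := (sdpair2 (aut_groupAction N)).

Lemma hol_actE n a : n \in N -> a \in Aut N -> S (a n) = S n ^ T a.
Proof. by move=> Nn Aa; rewrite -sdpair_act. Qed.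

Lemma hol_diagP u :
  reflect (exists2 d, d \in N^`(1) & u = S d^-1 * T (conj_aut N d))
          (u \in hol_diag N).
Proof.
have defd d : d \in N^`(1) ->
    hol_pair N d^-1 (inner_aut N d) = S d^-1 * T (conj_aut N d).
  move=> N'd; have Nd := subsetP (der_sub 1 N) d N'd.
  rewrite /hol_pair /inner_aut; congr (_ * T _).
  by rewrite (morphV (conj_aut_morphism N)) ?invgK ?(subsetP (normG N)).
apply: (iffP imsetP) => [] [d N'd ->]; exists d => //.
  exact: defd.
by rewrite defd.
Qed.

(** The two factors S d^-1 and T (conj_aut N d) act on [hol_base N] by mutually inverse
    conjugations. *)
Lemma hol_diag_cent : hol_diag N \subset 'C(hol_base N).
Proof.
have sN := subsetP (der_sub 1 N).
apply/centsP=> _ /hol_diagP[d N'd ->] _ /morphimP[n _ Nn ->].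
have Nd := sN d N'd; apply/commute_sym/commgP/conjg_fixP.
rewrite conjgM -(morphJ (sdpair1_morphism _)) ?groupV //.
rewrite -hol_actE ?groupJ ?groupV ?Aut_aut //.
by rewrite conj_autE ?groupJ ?groupV // conjgKV.
Qed.

(** Conjugation by T a carries the element attached to d to the one attached to a d, and N' is
    characteristic; [hol_base N] centralizes D. *)
Lemma hol_diag_normal : hol_diag N <| [set: hol N].
Proof.
have sN := subsetP (der_sub 1 N).
rewrite /normal subsetT -im_sdpair mul_subG //.
  by rewrite cents_norm // centsC hol_diag_cent.
apply/subsetP=> _ /morphimP[a _ Aa ->]; rewrite inE.
apply/subsetP=> _ /imsetP[_ /hol_diagP[d N'd ->] ->].
have Nd := sN d N'd; have N'ad : a d \in N^`(1).
  have /charP[_ cN] := der_char 1 N.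
  by rewrite -(autmE Aa) -(cN (autm Aa)) ?injm_autm ?im_autm // mem_morphim.
apply/hol_diagP; exists (a d) => //; rewrite conjMg -hol_actE ?groupV //.
rewrite -(autmE Aa) (morphV (autm_morphism Aa)) // autmE; congr (_ * _).
have Nad := sN _ N'ad.
rewrite -(morphJ (sdpair2_morphism _)) ?Aut_aut //=; congr T.
apply: (@eq_Aut _ N); rewrite ?groupJ ?Aut_aut //= => y Ny.
rewrite conjgE !permM conj_autE ?Aut_closed ?groupV // conj_autE //.
by rewrite -(autmE Aa) morphJ ?Aut_closed ?groupV //= !autmE permKV.
Qed.

Lemma hol_base_compl : hol_base N ><| (T @* Aut N)%G = [set: hol N].
Proof. exact: sdprod_sdpair. Qed.

(** The element attached to d lies in [hol_base N] exactly when conjugation by d is trivial on N,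
    that is, when d is central. *)
Lemma hol_base_diag_TI :
  (hol_base N :&: hol_diag N == 1) = ('Z(N) :&: N^`(1) == 1).
Proof.
have sN := subsetP (der_sub 1 N).
apply/eqP/eqP=> ti; apply/trivgP/subsetP=> x /setIP[].
  move=> /setIP[Nx /centP cNx] N'x; have Nx' : x^-1 \in N by rewrite groupV.
  have : S x^-1 \in hol_base N :&: hol_diag N.
    rewrite inE mem_morphim //=; apply/hol_diagP; exists x => //.
    suff ->: conj_aut N x = 1 by rewrite (morph1 (sdpair2_morphism _)) mulg1.
    apply: (@eq_Aut _ N); rewrite ?Aut_aut ?group1 // => y Ny.
    by rewrite perm1 conj_autE //; apply/conjg_fixP/commgP/commute_sym/cNx.
  rewrite ti => /set1P/(kerP (sdpair1_morphism _) Nx').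
  by move/(subsetP (injm_sdpair1 _))/set1P/eqP; rewrite invg_eq1 inE.
move=> /morphimP[n _ Nn ->] /hol_diagP[d N'd]; have Nd := sN d N'd.
move=> Sn; have : T (conj_aut N d) \in S @* N :&: T @* Aut N.
  rewrite inE [X in _ && X]mem_morphim ?Aut_aut // andbT.
  by rewrite -(mulKg (S d^-1) (T _)) -Sn groupM ?groupV ?mem_morphim ?groupV.
rewrite im_sdpair_TI Sn => /set1P /(kerP (sdpair2_morphism _) (Aut_aut _ _)).
move/(subsetP (injm_sdpair2 _))/set1P => cd1.
have : d \in 'Z(N) :&: N^`(1).
  rewrite inE N'd andbT inE Nd -ker_conj_aut; apply/kerP => //.
  exact: subsetP (normG N) _ Nd.
rewrite ti => /set1P->; rewrite (morph1 (conj_aut_morphism N)) invg1.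
by rewrite morph1 (morph1 (sdpair2_morphism _)) mulg1.
Qed.

End HolomorphDiagonal.

(** * From a lifted complement to Gaschütz's theorem *)

Lemma gaschutz_of_hol_complement (gT : finGroupType) (N : {group gT})
    (L : {group hol N}) :
    hol_diag N \subset L -> hol_base N * L = [set: hol N] ->
    hol_base N :&: L = 1 ->
  gaschutz_holds N.
Proof.
move=> sDL mulL tiL rT M H G /isogP[f injf defN] nMG sMH sHG coMGH splH.
have [K [defG tiMK]] := Gaschutz_derived_supplement nMG sMH sHG coMGH splH.
have nMK : K \subset 'N(M).
  by rewrite (subset_trans _ (normal_norm nMG)) // -defG mulG_subr.
(* The action of k on M by conjugation, transported to N along f. *)
pose a k := Aut_isom injf (subxx M) (conj_aut M k).
have aN k : a k \in Aut N.
  by have := Aut_Aut_isom injf (subxx M) (conj_aut M k); rewrite defN.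
have aE k m : k \in K -> m \in M -> a k (f m) = f (m ^ k).
  move=> Kk Mm; rewrite /a Aut_isomE ?Aut_aut //.
  by rewrite norm_conj_autE // (subsetP nMK).
pose h k := sdpair2 (aut_groupAction N) (a k).
have hM : {in K &, {morph h : k l / k * l}}.
  move=> k l Kk Kl; rewrite /h /a conj_aut_morphM ?(subsetP nMK) //.
  by rewrite Aut_isomM ?Aut_aut // sdpair2_morphM ?aN.
have fN m : m \in M -> f m \in N by move=> Mm; rewrite -defN mem_morphim.
have gM : {in M &, {morph sdpair1 (aut_groupAction N) \o f : m n / m * n}}.
  by move=> m n Mm Mn /=; rewrite (morphM f) ?sdpair1_morphM ?fN.
have im_g : Morphism gM @* M = hol_base N.
  by rewrite /= !morphimEdom imset_comp -(morphimEdom f) defN.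
apply: (@splits_of_supplement_morphisms _ _ M K G L
          (Morphism gM) (Morphism hM)) => //.
- apply/injmP=> m n Mm Mn /= eq_fmn.
  by apply: (injmP injf) => //; apply: (injmP (injm_sdpair1 _)) eq_fmn;
    apply: fN.
- by move=> m k Mm Kk; rewrite /= -aE // hol_actE ?fN ?aN.
- move=> d; rewrite tiMK => M'd; have Md := subsetP (der_sub 1 M) d M'd.
  have Kd : d \in K by move: M'd; rewrite -tiMK => /setIP[].
  (* Conjugation by d becomes conjugation by f d on N, so the discrepancy is the element of D
     attached to f d. *)
  apply: (subsetP sDL); apply/hol_diagP; exists (f d).
    by rewrite -defN -morphim_der // mem_morphim.
  rewrite /= (morphV f) //; congr (_ * sdpair2 _ _).
  apply: (@eq_Aut _ N); rewrite ?aN ?Aut_aut // => y.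
  rewrite -{1}defN => /morphimP[m _ Mm ->].
  by rewrite aE // conj_autE ?fN // morphJ.
- by rewrite im_g.
by rewrite im_g mulL subsetT.
Qed.

(** * The wreath product construction for the converse *)

Section WreathObstruction.

Variables (xT R : finGroupType) (M D : {group xT}).
(** The projection onto a complement of M, encoded as an idempotent endomorphism with kernel M. *)
Variable p : {morphism [set: xT] >-> xT}.

Hypotheses (kerp : 'ker p = M) (pp : forall x, p (p x) = p x).
Hypotheses (nD : D <| [set: xT]) (cDM : D \subset 'C(M)).
Hypothesis pD : {in D, forall d, d^-1 * p d \in M^`(1)}.
Hypotheses (R_gt1 : 1 < #|R|) (coMR : coprime #|M| #|R|).

Local Notation W := (wreath xT R).
Local Notation pT := (xT * W)%type.

Let pM x y : p (x * y) = p x * p y. Proof. by rewrite morphM ?inE. Qed.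
Let pV x : p x^-1 = (p x)^-1. Proof. by rewrite morphV ?inE. Qed.

Let memM x : (x \in M) = (p x == 1).
Proof. by rewrite -kerp !inE. Qed.

Let pJ x y : (x^-1 * y \in M) = (p x == p y).
Proof. by rewrite memM pM pV -eq_mulVg1. Qed.

(* The groups G, H and M of the header are wrG, wrH and wrM, taken modulo the *)
(* diagonal copy wrD of D; wrC is the complement of wrM in wrH.               *)
Let elt x s (f : R -> xT) : pT := (x, (s, finfun f)).

Let eltE (u : pT) : u = elt u.1 u.2.1 u.2.2.
Proof. by case: u => x [s f]; rewrite /elt /= ffunK. Qed.

Let eltM x s f y t g :
  elt x s f * elt y t g = elt (x * y) (s * t) (fun i => f (t * i) * g i).
Proof. by congr (_, (_, _)); apply/ffunP=> i; rewrite !ffunE. Qed.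

Let elt1 : 1 = elt 1 1 (fun=> 1).
Proof. by []. Qed.

Let elt_eq x s f g : f =1 g -> elt x s f = elt x s g.
Proof. by move=> eqfg; congr (_, (_, _)); apply/ffunP=> i; rewrite !ffunE. Qed.

Let wrG_set : {set pT} := [set u : pT | [forall i, p (u.2.2 i) == p u.1]].

Let wrG_elt x s f : reflect (forall i, p (f i) = p x) (elt x s f \in wrG_set).
Proof.
rewrite inE; apply: (iffP forallP) => fx i; have /= := fx i;
  by rewrite ffunE => /eqP.
Qed.

Let wrG_group_set : group_set wrG_set.
Proof.
apply/group_setP; split; first by rewrite elt1; apply/wrG_elt.
move=> u v; rewrite (eltE u) (eltE v) => /wrG_elt Gu /wrG_elt Gv.
by rewrite eltM; apply/wrG_elt=> i; rewrite !pM Gu Gv.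
Qed.

Let wrG := Group wrG_group_set.

Let rot (u : pT) := u.2.1.
Let rotM : {in wrG &, {morph rot : u v / u * v}}. Proof. by []. Qed.

Let wrH := ('ker (Morphism rotM))%G.

Let wrH_elt x s f : (elt x s f \in wrH) = (elt x s f \in wrG_set) && (s == 1).
Proof. by rewrite !inE. Qed.

Let wrC_set := [set u in wrH | u.1 == u.2.2 1].

Let wrC_elt x s f :
  (elt x s f \in wrC_set) = [&& elt x s f \in wrG_set, s == 1 & x == f 1].
Proof. by rewrite inE wrH_elt /= ffunE -andbA. Qed.

Let wrC_group_set : group_set wrC_set.
Proof.
apply/group_setP; split.
  by rewrite elt1 wrC_elt !eqxx -elt1 (group1 wrG).
move=> u v; rewrite (eltE u) (eltE v) eltM !wrC_elt.
case/and3P=> Gu /eqP su /eqP xu /and3P[Gv /eqP sv /eqP xv].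
have := @groupM _ wrG _ _ Gu Gv; rewrite eltM => Guv.
by apply/and3P; split=> //; rewrite ?xu ?xv ?su ?sv mul1g.
Qed.

Let wrC := Group wrC_group_set.

Let base (m : xT) : pT := pairg1 W m.
Let baseE m : base m = elt m 1 (fun=> 1). Proof. by []. Qed.

Let wrM := (pairg1 W @* M)%G.

Let wrM_elt x s f :
  reflect [/\ x \in M, s = 1 & f =1 fun=> 1] (elt x s f \in wrM).
Proof.
apply: (iffP morphimP) => [[m _ Mm [-> -> f1]] | [Mx -> f1]].
  by split=> // i; have /ffunP/(_ i) := f1; rewrite !ffunE.
by exists x => //; rewrite ?inE // (elt_eq _ _ f1).
Qed.

Let diag (d : xT) : pT := elt d 1 (fun=> d).

Let diagM : {in [set: xT] &, {morph diag : d e / d * e}}.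
Proof. by move=> d e _ _; rewrite /diag eltM mul1g. Qed.

Let wrD := (Morphism diagM @* D)%G.

Let wrD_elt x s f :
  reflect [/\ x \in D, s = 1 & f =1 fun=> x] (elt x s f \in wrD).
Proof.
apply: (iffP morphimP) => [[d _ Dd [-> -> fd]] | [Dx -> fx]].
  by split=> // i; have /ffunP/(_ i) := fd; rewrite !ffunE.
by exists x => //; rewrite ?inE //= /diag (elt_eq _ _ fx).
Qed.

Let sMG : wrM \subset wrG.
Proof.
apply/subsetP=> u; rewrite (eltE u) => /wrM_elt[Mx _ f1].
by apply/wrG_elt=> i; rewrite f1 morph1; apply/esym/eqP; rewrite -memM.
Qed.

Let sDC : wrD \subset wrC.
Proof.
apply/subsetP=> u; rewrite (eltE u) => /wrD_elt[Dx s1 fx].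
by rewrite wrC_elt s1 fx !eqxx !andbT; apply/wrG_elt=> i; rewrite fx.
Qed.

Let sCH : wrC \subset wrH.
Proof. by apply/subsetP=> u /setIdP[]. Qed.

Let sHG : wrH \subset wrG.
Proof. by apply/subsetP=> u /setIP[]. Qed.

Let sMH : wrM \subset wrH.
Proof.
apply/subsetP=> u Mu; have := subsetP sMG u Mu; move: Mu.
by rewrite (eltE u) => /wrM_elt[_ s1 _] Gu; rewrite wrH_elt Gu s1 /=.
Qed.

Let nMG : wrM <| wrG.
Proof.
rewrite /normal sMG; apply/subsetP=> u _; rewrite inE.
apply/subsetP=> _ /imsetP[_ /morphimP[m _ Mm ->] ->].
apply/morphimP; exists (m ^ u.1); rewrite ?inE //.
  by rewrite memM /conjg !pM pV (eqP (_ : p m == 1)) -?memM // mul1g mulVg.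
by congr (_, _); apply: conj1g.
Qed.

(** All coordinates x and f i of an element of [wrG] agree modulo M, which D centralizes, so they
    conjugate d in the same way. *)
Let nDG : wrD <| wrG.
Proof.
rewrite /normal (subset_trans sDC (subset_trans sCH sHG)).
apply/subsetP=> u; rewrite (eltE u) => /wrG_elt Gu; rewrite inE.
apply/subsetP=> _ /imsetP[_ /morphimP[d _ Dd ->] ->].
set x := u.1; set f := u.2.2; have Ddx : d ^ x \in D.
  by rewrite memJ_norm // (subsetP (normal_norm nD)) ?inE.
have defu : elt x u.2.1 f * diag (d ^ x) = diag d * elt x u.2.1 f.
  rewrite /diag !eltM mulg1 mul1g -conjgC; apply: elt_eq => i; rewrite !mul1g.
  have cxf : commute (d ^ x) (x^-1 * f i).
    by apply: (centsP cDM); rewrite // pJ Gu.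
  by rewrite -[f i](mulKVg x) -(mulgA x) -cxf !mulgA mulgV mul1g.
by rewrite conjgE -defu mulKg; apply: mem_morphim; rewrite ?inE.
Qed.

(** The function coordinate of a diagonal element records d, so this holds even when D itself meets
    M. Hence M survives in the quotient by [wrD] before Z(N) :&: N' = 1 is known. *)
Let tiMD : wrM :&: wrD = 1.
Proof.
apply/trivgP/subsetP=> u /setIP[]; rewrite (eltE u) => /wrM_elt[_ -> f1].
case/wrD_elt=> _ _ fx; have x1 : u.1 = 1 by rewrite -(fx 1) f1.
by rewrite inE x1 elt1; apply/eqP/elt_eq.
Qed.

Let tiMC : wrM :&: wrC = 1.
Proof.
apply/trivgP/subsetP=> u /setIP[]; rewrite (eltE u) => /wrM_elt[_ -> f1].
rewrite wrC_elt f1 => /and3P[_ _ /eqP->].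
by rewrite inE elt1; apply/eqP/elt_eq.
Qed.

Let mulMC : wrM * wrC = wrH.
Proof.
apply/eqP; rewrite eqEsubset mul_subG //=; apply/subsetP=> u.
rewrite (eltE u) wrH_elt => /andP[/wrG_elt Gu /eqP s1].
(* Splitting off x (f 1)^-1, which lies in M, leaves an element whose first coordinate equals f
   1. *)
rewrite -(mulKVg (base (u.1 * (u.2.2 1)^-1)) (elt _ _ _)) mem_mulg //.
  by rewrite mem_morphim ?inE // memM pM pV Gu mulgV.
have ->: (base (u.1 * (u.2.2 1)^-1))^-1 = base ((u.1 * (u.2.2 1)^-1)^-1).
  by rewrite /base (morphV (pairg1_morphism _ _)) ?inE.
rewrite baseE eltM invMg invgK mulgKV s1 mulg1 wrC_elt mul1g !eqxx !andbT.
by apply/wrG_elt=> i; rewrite mul1g !Gu.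
Qed.

(** The index is the order of the image of [rot], a subgroup of R. *)
Let coMG : coprime #|wrM| #|wrG : wrH|.
Proof.
rewrite card_injm ?injm_pairg1 ?subsetT //.
apply: coprime_dvdr coMR; rewrite -[#|R|]cardsT.
by rewrite -{1}(setIid wrG) -(card_morphim (Morphism rotM)) cardSg ?subsetT.
Qed.

Let single (a : xT) (i : R) := if i == 1 then a else 1.

Section WreathComplement.

Variable L : {group pT}.
Hypotheses (sDL : wrD \subset L) (mulL : wrM * L = wrG) (tiL : wrM :&: L = 1).

Let baseL m : m \in M -> base m \in L -> m = 1.
Proof.
move=> Mm Lm; have : base m \in wrM :&: L by rewrite inE Lm mem_morphim ?inE.
by rewrite tiL => /set1P[].
Qed.

Let wrG_baseL x s f :
  elt x s f \in wrG -> exists2 m, m \in M & elt (m * x) s f \in L.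
Proof.
rewrite -mulL => /imset2P[_ u /morphimP[m _ Mm ->] Lu def_u].
exists m^-1; rewrite ?groupV //; move: Lu.
have -> : u = base m^-1 * elt x s f; last first.
  by rewrite baseE eltM mul1g (@elt_eq _ _ _ f) // => i; rewrite mul1g.
by rewrite def_u /base (morphV (pairg1_morphism _ _)) ?inE // mulKg.
Qed.

Let expg_elt x s n : elt x s (fun=> 1) ^+ n = elt (x ^+ n) (s ^+ n) (fun=> 1).
Proof.
elim: n => [|n IHn]; first by rewrite !expg0.
by rewrite !expgS IHn eltM; apply: elt_eq => i; rewrite mulg1.
Qed.

(** Some (m, s, 1) lies in L, and its power with exponent |R| lies in [wrM] :&: L. So the order of m
    divides both |R| and |M|. *)
Let rotL s : elt 1 s (fun=> 1) \in L.
Proof.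
have /wrG_baseL[m Mm] : elt 1 s (fun=> 1) \in wrG by apply/wrG_elt.
rewrite mulg1 => Lms; suff m1 : m = 1 by rewrite m1 in Lms.
have sR : s ^+ #|R| = 1 by rewrite -cardsT expg_cardG ?inE.
have mR : m ^+ #|R| = 1.
  apply: baseL; rewrite ?groupX // baseE -sR -expg_elt.
  exact: groupX.
apply/eqP; rewrite -order_eq1 -dvdn1 -(eqnP coMR) dvdn_gcd order_dvdG //.
by rewrite /= order_dvdn mR.
Qed.

Let shiftL x f s : elt x 1 f \in L -> elt x 1 (fun i => f (s * i)) \in L.
Proof.
move=> Lf; have := groupJ Lf (rotL s).
have -> : elt x 1 f ^ elt 1 s (fun=> 1) = elt x 1 (fun i => f (s * i)) => //.
apply: (mulgI (elt 1 s (fun=> 1))); rewrite -conjgC !eltM !mulg1 !mul1g.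
by apply: elt_eq => i; rewrite mulg1 mul1g.
Qed.

Let eltR x f y g :
  [~ elt x 1 f, elt y 1 g] = elt [~ x, y] 1 (fun i => [~ f i, g i]).
Proof.
apply: (mulgI (elt y 1 g * elt x 1 f)); rewrite -commgC !eltM !mul1g.
by rewrite -commgC; apply: elt_eq => i; rewrite !mul1g -commgC.
Qed.

Let single_commgL a b : a \in M -> b \in M -> elt 1 1 (single [~ a, b]) \in L.
Proof.
have single_baseL c : c \in M -> exists2 m, m \in M & elt m 1 (single c) \in L.
  move=> Mc; have /wrG_baseL[m Mm] : elt 1 1 (single c) \in wrG.
    apply/wrG_elt=> i; rewrite /single morph1.
    case: eqP => _; last exact: morph1.
    by apply/eqP; rewrite -memM.
  by rewrite mulg1; exists m.
move=> Ma Mb; have [m Mm Lma] := single_baseL a Ma.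
have [n Mn Lnb] := single_baseL b Mb.
have [s _ s_neq1] : exists2 s : R, s \in [set: R] & s != 1.
  by apply/trivgPn; rewrite trivg_card1 cardsT gtn_eqF.
(* The shift by s moves the support of the first function to s^-1, away from that of the second, so
   the commutator has trivial function part. *)
have mn1 : [~ m, n] = 1.
  apply: baseL; first by rewrite groupR.
  have := groupR (shiftL s Lma) Lnb; rewrite eltR baseE.
  rewrite (@elt_eq _ _ _ (fun=> 1)) // => i; rewrite /single.
  case: (i =P 1) => [->|_]; last by rewrite commg1.
  by rewrite mulg1 (negPf s_neq1) comm1g.
have := groupR Lma Lnb; rewrite eltR mn1.
rewrite (@elt_eq _ _ _ (single [~ a, b])) // => i; rewrite /single.
by case: eqP => // _; rewrite comm1g.
Qed.

Let single_derL d : d \in M^`(1) -> elt 1 1 (single d) \in L.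
Proof.
pose E := [set d | elt 1 1 (single d) \in L].
have gE : group_set E.
  apply/group_setP; split.
    rewrite inE (@elt_eq _ _ _ (fun=> 1)) ?group1 // => i.
    by rewrite /single if_same.
  move=> x y; rewrite !inE => Lx Ly; have := groupM Lx Ly.
  rewrite eltM !mul1g (@elt_eq _ _ _ (single (x * y))) // => i.
  by rewrite mul1g /single; case: eqP; rewrite ?mulg1.
suff /subsetP sM'E : M^`(1) \subset Group gE by move/sM'E; rewrite inE.
rewrite derg1 gen_subG; apply/subsetP=> _ /imset2P[a b Ma Mb ->].
by rewrite inE single_commgL.
Qed.

(** A constant function is the product of its values placed at the single points of R, each obtained
    from the point 1 by a shift. *)
Let const_derL d : d \in M^`(1) -> elt 1 1 (fun=> d) \in L.
Proof.
move=> M'd; suff Ls (r : seq R) :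
    uniq r -> elt 1 1 (fun i => if i \in r then d else 1) \in L.
  have := Ls _ (enum_uniq R); rewrite (@elt_eq _ _ _ (fun=> d)) // => i.
  by rewrite mem_enum.
elim: r => [|s r IHr] /=; first by rewrite group1.
case/andP=> r's /IHr Lr; have := groupM (shiftL s^-1 (single_derL M'd)) Lr.
rewrite eltM !mul1g.
rewrite (@elt_eq _ _ _ (fun i => if i \in s :: r then d else 1)) // => i.
rewrite mul1g /single inE -eq_mulVg1 eq_sym.
by case: eqP => [->|_]; rewrite ?(negPf r's) ?mulg1 ?mul1g.
Qed.

Let emb x := elt x 1 (fun=> p x).

Let embM : {in [set: xT] &, {morph emb : x y / x * y}}.
Proof. by move=> x y _ _; rewrite /emb eltM mul1g pM. Qed.

Lemma complement_of_wreath_complement :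
  exists K : {group xT}, [/\ D \subset K, M * K = [set: xT] & M :&: K = 1].
Proof.
have emb_base m : m \in M -> emb m = base m.
  by rewrite memM /emb baseE => /eqP->.
exists (Morphism embM @*^-1 L)%G; split.
- apply/subsetP=> d Dd; rewrite !inE /=.
  have Ld : diag d \in L.
    by apply: (subsetP sDL); apply: mem_morphim; rewrite ?inE.
  (* The constant d^-1 * p d, with value in M', turns [diag d] into [emb d]. *)
  have := groupM Ld (const_derL (pD Dd)); rewrite eltM mulg1 mul1g.
  by rewrite (@elt_eq _ _ _ (fun=> p d)) // => i; rewrite mulKVg.
- apply/eqP; rewrite eqEsubset subsetT; apply/subsetP=> x _.
  have /wrG_baseL[m Mm Lmx] : emb x \in wrG by apply/wrG_elt=> i; rewrite pp.
  rewrite -(mulKg m x) mem_mulg ?groupV // !inE /= /emb pM.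
  by move: Mm; rewrite memM => /eqP->; rewrite !mul1g.
apply/trivgP/subsetP=> m /setIP[Mm]; rewrite !inE /= emb_base // => Lm.
by rewrite (baseL Mm).
Qed.

End WreathComplement.

Lemma complement_of_gaschutz : gaschutz_holds M ->
  exists K : {group xT}, [/\ D \subset K, M * K = [set: xT] & M :&: K = 1].
Proof.
move=> gasM; have nDM := subset_trans sMG (normal_norm nDG).
have isoM : wrM / wrD \isog M.
  rewrite isog_sym.
  apply: isog_trans (sub_isog (subsetT M) (injm_pairg1 _ _)) _.
  by apply: quotient_isog => //; rewrite setIC.
have: [splits wrG / wrD, over wrM / wrD].
  apply: (gasM _ (wrM / wrD)%G (wrH / wrD)%G (wrG / wrD)%G isoM).
  - exact: quotient_normal.
  - exact: quotientS.
  - exact: quotientS.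
  - rewrite -(card_isog (quotient_isog nDM _)) 1?setIC //.
    rewrite index_quotient_eq ?normal_norm //.
    by rewrite subIset // (subset_trans sDC sCH) orbT.
  apply/splits_quotientP => //; last by exists wrC.
  exact: normalS (subset_trans sDC sCH) sHG nDG.
case/splits_quotientP=> // L [sDL mulL tiL].
exact: complement_of_wreath_complement tiL.
Qed.

End WreathObstruction.

(** * The equivalence for the holomorph *)

Theorem theorem1 (gT : finGroupType) (N : {group gT}) :
  hol_diag N <| [set: hol N] /\
  (gaschutz_holds N <->
     'Z(N) :&: N^`(1) = 1 /\
     [splits [set: hol N] / hol_diag N, over hol_base N / hol_diag N]).
Proof.
have nD := hol_diag_normal N; split=> //.
have compl_splits : 'Z(N) :&: N^`(1) = 1 ->
    reflect (exists L : {group hol N},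
               [/\ hol_diag N \subset L, hol_base N * L = [set: hol N]
                 & hol_base N :&: L = 1])
            [splits [set: hol N] / hol_diag N, over hol_base N / hol_diag N].
  move=> tiN; apply: (splits_quotientP (K := hol_diag_group N)) => //.
    exact: subsetT.
  by apply/eqP; rewrite hol_base_diag_TI tiN.
split=> [gasN | [tiN /(compl_splits tiN)[L [sDL mulL tiL]]]]; last first.
  exact: gaschutz_of_hol_complement sDL mulL tiL.
have isoN : N \isog hol_base N by apply: sub_isog (subxx N) (injm_sdpair1 _).
have gasB := gaschutz_isog isoN gasN.
(* A prime r above |N| makes the cyclic group of order r nontrivial and of order prime to |N|. *)
have [r ltNr pr_r] := prime_above #|N|.
have r_gt1 := prime_gt1 pr_r.
have card_r : #|'Z_r| = r by rewrite card_ord Zp_cast.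
have nB : hol_base N <| [set: hol N] by case/sdprod_context: (hol_base_compl N).
pose A := (sdpair2 (aut_groupAction N) @* Aut N)%G.
have complA : A \in [complements to hol_base N in [set: hol N]].
  exact: sdprod_compl (hol_base_compl N).
have [_ mulBA _ tiBA] := sdprodP (hol_base_compl N).
pose p := Morphism (remgrM complA nB).
have pA x : p x \in A by rewrite mem_remgr // mulBA inE.
have kerp : 'ker p = hol_base N.
  apply/setP=> x; rewrite !inE /=; apply/eqP/idP=> [px1 | ]; last exact: remgr1.
  by rewrite (divgr_eq (hol_base N) A x) px1 mulg1 mem_divgr // mulBA inE.
have pp x : p (p x) = p x by apply: (remgr_id tiBA (pA x)).
(* The projection of u = S d^-1 * T c, with c conjugation by d, is T c, and u^-1 * p u = S (c d) = S
   d. *)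
have pD : {in hol_diag N, forall d, d^-1 * p d \in (hol_base N)^`(1)}.
  move=> _ /hol_diagP[d N'd ->]; have Nd := subsetP (der_sub 1 N) d N'd.
  rewrite /= (remgrMid tiBA) ?mem_morphim ?groupV ?Aut_aut //.
  rewrite (morphV (sdpair1_morphism _)) // invMg invgK -mulgA -conjgE.
  rewrite -hol_actE ?Aut_aut // conj_autE // conjgE mulKg.
  by rewrite -morphim_der // mem_morphim.
have coNr : coprime #|hol_base N| #|'Z_r|.
  rewrite -(card_isog isoN) card_r coprime_sym prime_coprime //.
  by apply: contraL ltNr => /dvdn_leq; rewrite -leqNgt; apply.
have R_gt1 : 1 < #|'Z_r| by rewrite card_r.
have [L [sDL mulL tiL]] :=
  complement_of_gaschutz kerp pp nD (hol_diag_cent N) pD R_gt1 coNr gasB.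
have tiN : 'Z(N) :&: N^`(1) = 1.
  apply/eqP; rewrite -hol_base_diag_TI; apply/eqP/trivgP.
  by rewrite -tiL setIS.
by split=> //; apply/compl_splits=> //; exists L.
Qed.
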